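(* For $n,m\in\mathbb{N}$ let $h(n,m)$ denote the number of partitions of $n$ into $m$ parts such that each part appears at most twice. Then $$\sum_{m,n\ge 0}h(n,m)q^nt^m=\sum_{\beta}\frac{q^{|\beta|}\,t^{2n_2+n_1}}{(q;q)_{n_{12}}\,(q^3;q^3)_{n_2}},\qquad n_1=n_{11}+n_{12},$$ where the sum on the right runs over all base partitions $\beta$, and for each $\beta$ the integers $n_2=n_2(\beta)$, $n_{11}=n_{11}(\beta)$, $n_{12}=n_{12}(\beta)\ge 0$ are respectively the number of pairs, of immobile singletons, and of moveable singletons of $\beta$.
   Context: A partition is a finite nondecreasing sequence of positive integers (its parts; the empty sequence is the only partition of $0$); its weight $|\lambda|$ is the sum of its parts. $|q|<1$ (or: identities of formal power series). $(a;q)_0=1$, $(a;q)_n=(1-a)(1-aq)\cdots(1-aq^{n-1})$. The following notions concern partitions in which each part appears at most twice. Pairs and singletons. Read the parts $\lambda_1\le\lambda_2\le\cdots$ from left to right: at the current part $\lambda_i$, if $\lambda_{i+1}$ exists and $\lambda_{i+1}-\lambda_i\in\{0,1\}$, then $[\lambda_i,\lambda_{i+1}]$ is declared a pair and one continues with $\lambda_{i+2}$; otherwise $\lambda_i$ is declared a singleton and one continues with $\lambda_{i+1}$. So each pair is a pair of repeating parts $[k,k]$ or a pair of consecutive parts $[k,k+1]$. Backward moves on pairs. A backward move on a pair replaces $[k,k+1]$ by $[k-1,k-1]$, or $[k,k]$ by $[k-2,k-1]$ (after which the parts are re-sorted and pairs are determined anew). It is possible only if all parts of the result are positive, each part of the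 result appears at most twice, and the pair is not moved through another pair, i.e. the smaller part of the moved pair is at least the larger part of the immediately preceding pair (if there is one). Base partitions. A base partition is a partition $\beta$ with each part appearing at most twice such that (i) no backward move is possible on any pair of $\beta$; (ii) the singletons located after the last (largest) pair (all singletons, if there are no pairs) are exactly $k+1,k+3,\dots,k+2n_{12}-1$ for some $n_{12}\ge0$, where the largest pair is $[k,k]$ or $[k,k+1]$, and $k=0$ if there are no pairs. The singletons in (ii) are the moveable singletons of $\beta$; the other singletons, which lie between pairs, are the immobile singletons of $\beta$. *)

(* Defs.v *)
From HB Require Import structures.
From mathcomp Require Import all_boot all_order all_algebra.
From mathcomp Require Import boolp.

Set Implicit Arguments.
Unset Strict Implicit.
Unset Printing Implicit Defensive.

Import GRing.Theory.
Local Open Scope ring_scope.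

Record fps (R : Type) := Fps { fcoef : nat -> R }.

Lemma fpsP (R : Type) (a b : fps R) : fcoef a =1 fcoef b -> a = b.
Proof. by case: a b => [a] [b] /= /funext ->. Qed.

HB.instance Definition _ (R : Type) := gen_eqMixin (fps R).
HB.instance Definition _ (R : Type) := gen_choiceMixin (fps R).

Section FpsRing.
Variable R : comNzRingType.
Implicit Types a b c : fps R.

Definition fpsC (x : R) : fps R := Fps (fun n => if n == 0%N then x else 0).
Definition fpsX : fps R := Fps (fun n => (n == 1%N)%:R).
Definition fps_add a b : fps R := Fps (fun n => fcoef a n + fcoef b n).
Definition fps_opp a : fps R := Fps (fun n => - fcoef a n).
Definition fps_mul a b : fps R :=
  Fps (fun n => \sum_(i < n.+1) fcoef a i * fcoef b (n - i)).

Fact fps_addA : associative fps_add.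
Proof. by move=> a b c; apply: fpsP => n /=; rewrite addrA. Qed.
Fact fps_addC : commutative fps_add.
Proof. by move=> a b; apply: fpsP => n /=; rewrite addrC. Qed.
Fact fps_add0 : left_id (fpsC 0) fps_add.
Proof. by move=> a; apply: fpsP => n /=; case: eqP => _; rewrite add0r. Qed.
Fact fps_addN : left_inverse (fpsC 0) fps_opp fps_add.
Proof. by move=> a; apply: fpsP => n /=; rewrite addNr; case: eqP. Qed.

HB.instance Definition _ :=
  GRing.isZmodule.Build (fps R) fps_addA fps_addC fps_add0 fps_addN.

Definition fps_trunc m a : {poly R} := \poly_(i < m) fcoef a i.

Fact fcoef_mul_trunc m n a b : (n < m)%N ->
  fcoef (fps_mul a b) n = (fps_trunc m a * fps_trunc m b)`_n.
Proof.
move=> nm; rewrite coefM; apply: eq_bigr => -[i /= ilt] _.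
by rewrite !coef_poly (leq_trans ilt nm) (leq_ltn_trans (leq_subr _ _) nm).
Qed.

Fact coef_trunc_mul m n a (p : {poly R}) : (n < m)%N ->
  (forall i, (i < m)%N -> fcoef a i = p`_i) ->
  forall b, fcoef (fps_mul a b) n = (p * fps_trunc m b)`_n.
Proof.
move=> nm ap b; rewrite coefM; apply: eq_bigr => -[i /= ilt] _.
by rewrite coef_poly (leq_ltn_trans (leq_subr _ _) nm) ap // (leq_trans ilt).
Qed.

Fact fps_mulC : commutative fps_mul.
Proof.
by move=> a b; apply: fpsP => n; rewrite !(@fcoef_mul_trunc n.+1) // mulrC.
Qed.

Fact fps_mulA : associative fps_mul.
Proof.
move=> a b c; apply: fpsP => n.
rewrite [fps_mul a _]fps_mulC.
rewrite (@coef_trunc_mul n.+1 n _ (fps_trunc n.+1 b * fps_trunc n.+1 c)) //;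
  last by move=> i ilt; rewrite (fcoef_mul_trunc _ _ ilt).
rewrite (@coef_trunc_mul n.+1 n _ (fps_trunc n.+1 a * fps_trunc n.+1 b)) //;
  last by move=> i ilt; rewrite (fcoef_mul_trunc _ _ ilt).
by congr (_ `_ n); rewrite mulrC mulrA.
Qed.

Fact fps_mul1 : left_id (fpsC 1) fps_mul.
Proof.
move=> a; apply: fpsP => n /=; rewrite big_ord_recl /= mul1r subn0.
by rewrite big1 ?addr0 // => i _; rewrite mul0r.
Qed.

Fact fps_mulDl : left_distributive fps_mul fps_add.
Proof.
move=> a b c; apply: fpsP => n /=; rewrite -big_split /=.
by apply: eq_bigr => i _; rewrite mulrDl.
Qed.

Fact fps_oner_neq0 : fpsC 1 != 0 :> fps R.
Proof.
by apply/eqP => /(congr1 (fun a => fcoef a 0)) /= /eqP; rewrite oner_eq0.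
Qed.

HB.instance Definition _ := GRing.Zmodule_isComNzRing.Build (fps R)
  fps_mulA fps_mulC fps_mul1 fps_mulDl fps_oner_neq0.

Lemma fcoef0 n : fcoef (0 : fps R) n = 0.
Proof. by rewrite /=; case: eqP. Qed.
Lemma fcoef1 n : fcoef (1 : fps R) n = (n == 0%N)%:R.
Proof. by rewrite /=; case: eqP. Qed.
Lemma fcoefD a b n : fcoef (a + b) n = fcoef a n + fcoef b n.
Proof. by []. Qed.
Lemma fcoefN a n : fcoef (- a) n = - fcoef a n.
Proof. by []. Qed.
Lemma fcoefM a b n :
  fcoef (a * b) n = \sum_(i < n.+1) fcoef a i * fcoef b (n - i).
Proof. by []. Qed.
Lemma fcoefC x n : fcoef (fpsC x) n = if n == 0%N then x else 0.
Proof. by []. Qed.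
Lemma fcoefCM x a n : fcoef (fpsC x * a) n = x * fcoef a n.
Proof.
rewrite fcoefM big_ord_recl /= subn0 big1 ?addr0 // => i _.
by rewrite mul0r.
Qed.
Lemma fcoefXM a n : fcoef (fpsX * a) n = if n is k.+1 then fcoef a k else 0.
Proof.
case: n => [|n]; first by rewrite fcoefM big_ord1 /= mul0r.
rewrite fcoefM big_ord_recl /= mul0r add0r big_ord_recl /= mul1r subSS subn0.
by rewrite big1 ?addr0 // => i _; rewrite mul0r.
Qed.
Lemma fcoefXn k n : fcoef (fpsX ^+ k) n = (n == k)%:R.
Proof.
elim: k n => [|k IH] n; first by rewrite expr0 fcoef1.
by rewrite exprS fcoefXM; case: n => [|n] //; rewrite IH.
Qed.

Lemma fpsC_is_additive x y : fpsC (x - y) = fpsC x - fpsC y.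
Proof. by apply: fpsP => n /=; case: eqP; rewrite ?subr0. Qed.
Lemma fpsC_is_monoid_morphism : monoid_morphism fpsC.
Proof.
split=> // x y; apply: fpsP => n; rewrite fcoefCM !fcoefC.
by case: eqP; rewrite ?mulr0.
Qed.
HB.instance Definition _ := GRing.isZmodMorphism.Build R (fps R) fpsC
  fpsC_is_additive.
HB.instance Definition _ := GRing.isMonoidMorphism.Build R (fps R) fpsC
  fpsC_is_monoid_morphism.

Lemma fcoef_sum (I : Type) (r : seq I) (P : pred I) (F : I -> fps R) n :
  fcoef (\sum_(i <- r | P i) F i) n = \sum_(i <- r | P i) fcoef (F i) n.
Proof. by elim/big_rec2: _ => [|i y _ _ <-] //; exact: fcoef0. Qed.

Lemma fcoefX_lt u k n : fcoef u 0 = 0 -> (n < k)%N -> fcoef (u ^+ k) n = 0.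
Proof.
move=> u0; elim: k n => // k IH n; rewrite ltnS => nk.
rewrite exprS fcoefM big_ord_recl u0 mul0r add0r big1 // => i _.
rewrite IH ?mulr0 //; apply: leq_trans nk.
by rewrite lift0 ltn_subrL /= (leq_ltn_trans _ (ltn_ord i)).
Qed.

End FpsRing.

Section FpsUnitRing.
Variable R : comUnitRingType.
Implicit Types a b : fps R.

Definition fps_unit : pred (fps R) := fun a => fcoef a 0 \is a GRing.unit.

(* Writing a = a_0 * (1 - u), the inverse is a_0^-1 * (1 + u + u^2 + ...);
   as u has no constant term, u^k does not contribute to the n-th coefficient
   when k > n. *)
Definition fps_geom_inv a : fps R :=
  let u := 1 - fpsC (fcoef a 0)^-1 * a in
  Fps (fun n => (fcoef a 0)^-1 * fcoef (\sum_(k < n.+1) u ^+ k) n).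
Definition fps_inv a : fps R := if fps_unit a then fps_geom_inv a else a.

Fact fps_mulVr : {in fps_unit, left_inverse 1 fps_inv *%R}.
Proof.
move=> a a0U; rewrite /fps_inv [fps_unit a]a0U mulrC.
have {}a0U : fcoef a 0 \is a GRing.unit := a0U.
set u := 1 - fpsC (fcoef a 0)^-1 * a.
have u0 : fcoef u 0 = 0.
  by rewrite /u fcoefD fcoefN fcoefCM fcoef1 mulVr // subrr.
have aE : a = fpsC (fcoef a 0) * (1 - u).
  by rewrite /u opprB addrC subrK mulrA -rmorphM /= mulrV // rmorph1 mul1r.
apply: fpsP => n.
have -> : fcoef (a * fps_geom_inv a) n =
          fcoef (a * (fpsC (fcoef a 0)^-1 * \sum_(k < n.+1) u ^+ k)) n.
  rewrite !fcoefM; apply: eq_bigr => i _; congr (_ * _).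
  rewrite fcoefCM /= -/u; congr (_ * _).
  rewrite !fcoef_sum (big_ord_widen n.+1 (fun k => fcoef (u ^+ k) (n - i)))
    ?ltnS ?leq_subr //.
  rewrite big_mkcond /=; apply: eq_bigr => k _.
  by case: ltnP => // /(fcoefX_lt u0) ->.
rewrite {1}aE mulrACA -rmorphM mulrV // rmorph1 mul1r.
rewrite -[1 - u]opprB mulNr -subrX1 opprB fcoefD fcoefN.
by rewrite (fcoefX_lt u0) // subr0.
Qed.

Fact fps_unitPl a b : b * a = 1 -> fps_unit a.
Proof.
move=> /(congr1 (fun c => fcoef c 0)); rewrite fcoefM big_ord1 fcoef1 /= => ba1.
by apply/unitrPr; exists (fcoef b 0); rewrite mulrC.
Qed.

Fact fps_inv_out : {in [predC fps_unit], fps_inv =1 id}.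
Proof. by move=> a aNU; rewrite /fps_inv [fps_unit a](negbTE aNU). Qed.

HB.instance Definition _ := GRing.ComNzRing_hasMulInverse.Build (fps R)
  fps_mulVr fps_unitPl fps_inv_out.

Lemma fps_unitE a : (a \is a GRing.unit) = (fcoef a 0 \is a GRing.unit).
Proof. by []. Qed.

End FpsUnitRing.

(* Power series in q and t over int, as power series in t whose coefficients
   are power series in q. *)
Notation fps2 := (fps (fps int)).

Definition qv : fps2 := fpsC (fpsX int).
Definition tv : fps2 := fpsX (fps int).

Definition coef2 (F : fps2) (n m : nat) : int := fcoef (fcoef F m) n.

Definition series2 (c : nat -> nat -> int) : fps2 :=
  Fps (fun m => Fps (fun n => c n m)).

Lemma coef2_series2 c n m : coef2 (series2 c) n m = c n m.
Proof. by []. Qed.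

Lemma coef2_monomial i j n m :
  coef2 (qv ^+ i * tv ^+ j) n m = ((n == i) && (m == j))%:R.
Proof.
rewrite /coef2 /qv -rmorphXn fcoefCM fcoefXn.
case: (m == j); rewrite ?mulr1n ?mulr0n ?andbT ?andbF.
  by rewrite mulr1 fcoefXn.
by rewrite mulr0 fcoef0.
Qed.

(* Summable families, in the sense of formal power series: each coefficient
   receives only finitely many nonzero contributions. *)
Definition fps2_has_sum (I : eqType) (F : I -> fps2) (S : fps2) : Prop :=
  forall n m : nat, exists r : seq I,
    [/\ uniq r,
        forall i, i \notin r -> coef2 (F i) n m = 0 &
        coef2 S n m = \sum_(i <- r) coef2 (F i) n m].

(* (a; q)_n *)
Definition qpoch (R : nzRingType) (a q : R) (n : nat) : R :=
  \prod_(i < n) (1 - a * q ^+ i).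

(* Inversion is the identity on non-units, hence the relevance of: *)
Lemma qpoch_unit k n : qpoch (qv ^+ k.+1) (qv ^+ k.+1) n \is a GRing.unit.
Proof.
apply: rpred_prod => i _.
rewrite -exprM -exprD -rmorphXn /= fps_unitE fcoefD fcoefN fcoef1 fcoefC /=.
by rewrite fps_unitE fcoefD fcoefN fcoef1 fcoefXn /= subr0 unitr1.
Qed.

Local Open Scope nat_scope.

Definition is_partition (s : seq nat) : bool :=
  sorted leq s && all (fun a => 0 < a) s.

Definition at_most_twice (s : seq nat) : bool :=
  all (fun a => count_mem a s <= 2) s.

Definition weight (s : seq nat) : nat := sumn s.

(* The parts of a partition of n are at most n. *)
Definition h (n m : nat) : nat :=
  #|[set p : m.-tuple 'I_n.+1 |
      let s := [seq val a | a <- p] in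
      [&& is_partition s, at_most_twice s & weight s == n]]|.

(* [inl (a, b)] is the pair [a, b] and [inr a] the singleton a. *)
Definition block : Type := (nat * nat) + nat.

(* Meaningful on nondecreasing sequences. *)
Fixpoint blocks (s : seq nat) : seq block :=
  match s with
  | a :: (b :: s'') as s' =>
      if (b == a) || (b == a.+1) then inl (a, b) :: blocks s''
      else inr a :: blocks s'
  | [:: a] => [:: inr a]
  | [::] => [::]
  end.

Definition block_parts (x : block) : seq nat :=
  match x with inl p => [:: p.1; p.2] | inr a => [:: a] end.

Definition is_pair (x : block) : bool := if x is inl _ then true else false.

Definition pairs (bs : seq block) : seq (nat * nat) :=
  pmap (fun x => if x is inl p then Some p else None) bs.

Definition singletons (bs : seq block) : seq nat :=
  pmap (fun x => if x is inr a then Some a else None) bs.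

(* The subtraction is truncated: a part that would be nonpositive becomes 0. *)
Definition move_pair (p : nat * nat) : nat * nat :=
  if p.1 == p.2 then (p.1 - 2, p.1 - 1) else (p.1 - 1, p.1 - 1).

Definition move_result (l r : seq block) (p : nat * nat) : seq nat :=
  sort leq (flatten [seq block_parts x | x <- l ++ inl (move_pair p) :: r]).

(* l and r are the blocks before and after p; the last conjunct says that the
   moved pair does not pass the preceding pair. *)
Definition move_possible (l r : seq block) (p : nat * nat) : bool :=
  [&& is_partition (move_result l r p),
      at_most_twice (move_result l r p) &
      if rev (pairs l) is p' :: _ then p'.2 <= (move_pair p).1 else true].

Definition no_backward_move (s : seq nat) : bool :=
  let bs := blocks s in
  all (fun i => if nth (inr 0) bs i is inl p
                then ~~ move_possible (take i bs) (drop i.+1 bs) p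
                else true)
      (iota 0 (size bs)).

(* The number of blocks up to and including the last pair (0 if none). *)
Definition last_pair_end (bs : seq block) : nat :=
  size bs - find is_pair (rev bs).

Definition immobile (s : seq nat) : seq nat :=
  singletons (take (last_pair_end (blocks s)) (blocks s)).

Definition moveable (s : seq nat) : seq nat :=
  singletons (drop (last_pair_end (blocks s)) (blocks s)).

(* The default (0, 0) gives k = 0 when there are no pairs. *)
Definition is_base (s : seq nat) : bool :=
  let k := (last (0, 0) (pairs (blocks s))).1 in
  [&& is_partition s, at_most_twice s, no_backward_move s &
      moveable s == [seq k + i.*2.+1 | i <- iota 0 (size (moveable s))]].

Definition base_partition : Type := {s : seq nat | is_base s}.

Definition n2 (b : base_partition) : nat := size (pairs (blocks (val b))).
Definition n11 (b : base_partition) : nat := size (immobile (val b)).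
Definition n12 (b : base_partition) : nat := size (moveable (val b)).
Definition n1 (b : base_partition) : nat := n11 b + n12 b.

(* Main.v *)
Require Import Defs.
From HB Require Import structures.
From mathcomp Require Import all_boot all_order all_algebra.
From mathcomp Require Import zify ring.
Import GRing.Theory.
Local Open Scope ring_scope.

Set Implicit Arguments.
Unset Strict Implicit.
Unset Printing Implicit Defensive.

(** The identity is proved by showing that both sides satisfy the same
    functional equation; no bijection between partitions and decorated base
    partitions is constructed.

    Base partitions are rigid.  A backward move on a pair is obstructed only by
    the preceding pair and by the singletons in between
    ([move_possible_local]), and this leaves very few ways to go on:
    after [k,k] the next pair is [k+1,k+1], [k+1,k+2] or [k+2,k+2]; after
    [k,k+1] it is [k+1,k+2], [k+2,k+2] or [k+2,k+3], or else the singleton k+1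
    followed by [k+3,k+3] ([extensionsP]).  The beginning of the partition
    behaves like the pair [0,0].  Hence the base partitions with b pairs and a
    moveable singletons form an explicit finite list ([bases], [basesP]).

    Write T = t q^k, and let E_b(k) and O_b(k) be the contributions to the
    right-hand side of the continuations with b pairs of a word that ends with
    [k,k], respectively [k,k+1].  Then E_0(k) = O_0(k) is the sum over a of
    t^a q^(a^2+ak) / (q;q)_a, and the list above says that
      (1 - q^(3b+3)) E_(b+1)(k) =
        T^2 (q^2 E_b(k+1) + q^3 O_b(k+1) + q^4 E_b(k+2)),
      (1 - q^(3b+3)) O_(b+1)(k) =
        T^2 (q^3 O_b(k+1) + q^4 E_b(k+2) + q^5 O_b(k+2) + T q^7 E_b(k+3)).
    The heart of the proof is a pair of identities obtained together by
    induction on b ([pairs_shift]):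
      q^(3b) E_b(k) = O_b(k+1) + T q E_b(k+2),
      q^(3b) O_b(k) = E_b(k+2) + T q O_b(k+2) + T q^2 E_b(k+3).
    They trade the factor q^(3b), the effect of moving each pair once, for
    shifts of k.  Once the factor is eliminated, what remains is a recurrence
    in k for E_b ([base_gf_rec]), and summing it over b gives
      S(k) = (1 + T q + T^2 q^2) S(k+1),  S = E_0 + E_1 + E_2 + ...
    ([tdvd_defect]).  Since S(k+1) is S(k) with tq substituted for t, this
    determines S(0) up to its constant term ([partial_coef_rec]).

    On the other side, subtracting 1 from every part of a partition and
    erasing the resulting zeros, of which there are at most two, gives
    h(n+m,m) = h(n,m) + h(n,m-1) + h(n,m-2) ([h_rec]): the same equation.

    Infinite sums over b and a are handled modulo powers of t, because b pairs
    contribute a multiple of t^b, and a moveable singletons one of t^a. *)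

Local Open Scope nat_scope.

(** * Partitions as words of blocks *)

Definition parts (bs : seq block) : seq nat := flatten (map block_parts bs).

Arguments parts : simpl never.
Arguments blocks : simpl never.

Lemma parts_cons b bs : parts (b :: bs) = block_parts b ++ parts bs.
Proof. by []. Qed.

Lemma parts_cat l r : parts (l ++ r) = parts l ++ parts r.
Proof. by rewrite /parts map_cat flatten_cat. Qed.

(** The arguments k and o stand for a preceding pair [k, k+o]: further parts
    exceed k and, if o, at most one more part is k+1.
    A singleton a leaves as much room as the pair [a+1, a+1], as a next part
    a+1 would have been paired with it; the empty prefix leaves as much room as
    the pair [0, 0]. *)
Fixpoint valid (k : nat) (o : bool) (bs : seq block) : bool :=
  match bs with
  | [::] => true
  | inr a :: bs' => (k < a) && valid a.+1 false bs'
  | inl (x, y) :: bs' =>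
      [&& k < x, (y == x) || (y == x.+1), ~~ (o && (y == k.+1))
        & valid x (y != x) bs']
  end.

Lemma valid_single k o a bs :
  valid k o (inr a :: bs) = (k < a) && valid a.+1 false bs.
Proof. by []. Qed.

(** The partitions, without their division into blocks, that can continue one
    whose last pair is [k, k+o]; see [valid_follows] and [follows_valid]. *)
Definition follows (k : nat) (o : bool) (s : seq nat) : Prop :=
  [/\ sorted leq s, all (fun x => k < x) s, forall x, count_mem x s <= 2
    & o -> count_mem k.+1 s <= 1].

Lemma at_most_twiceP s :
  reflect (forall x, count_mem x s <= 2) (at_most_twice s).
Proof.
apply: (iffP allP) => [H x|H x _]; last exact: H.
by case: (boolP (x \in s)) => [/H//|/count_memPn ->].
Qed.

Lemma followsP s :
  reflect (follows 0 false s) (is_partition s && at_most_twice s).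
Proof.
apply: (iffP idP) => [/andP[/andP[s1 s2] /at_most_twiceP s3]|[s1 s2 /at_most_twiceP s3 _]].
  by split.
by rewrite /is_partition s1 s2.
Qed.

Lemma path_all_leq x s : path leq x s = sorted leq s && all (leq x) s.
Proof. by rewrite (path_sortedE leq_trans) andbC. Qed.

Lemma count_memC x (s : seq nat) : all (fun y => x < y) s -> count_mem x s = 0.
Proof. by move=> /allP H; apply/count_memPn/negP => /H; rewrite ltnn. Qed.

Lemma valid_follows k o bs : valid k o bs -> follows k o (parts bs).
Proof.
elim: bs k o => [|[[x y]|a] bs IH] k o /=.
- by split.
- case/and4P => kx yx oy /IH; rewrite parts_cons => -[s1 s2 s3 s4].
  have s2' : all (fun z => x <= z) (parts bs) by apply: sub_all s2 => z /ltnW.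
  have yx2 : x <= y by case/orP: yx => /eqP ->.
  have s2y : all (fun z => y <= z) (parts bs).
    by case/orP: yx => /eqP ->.
  split=> /=.
  + by rewrite yx2 path_all_leq s1 s2y.
  + by rewrite kx (leq_trans kx yx2) /=; apply: sub_all s2 => z; apply: ltn_trans.
  + move=> z; have := s3 z; have := count_memC s2.
    case: (eqVneq x z) => [<- ->|xz _]; first by case: eqP.
    case: (eqVneq y z) => [yz|_ //]; rewrite -yz add0n add1n ltnS in s4 * => _.
    have yxE : y != x by rewrite yz eq_sym.
    by have := s4 yxE; move: yx; rewrite (negPf yxE) /= => /eqP ->.
  + move=> oT; move: oy; rewrite oT /= => /negPf oy; rewrite oy add0n.
    rewrite (count_memC (s := parts bs)) ?addn0; first by case: eqP.
    by apply: sub_all s2 => z; apply: leq_trans.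
- case/andP => ka /IH; rewrite parts_cons => -[s1 s2 s3 s4].
  have s2' : all (fun z => a < z) (parts bs) by apply: sub_all s2 => z /ltnW.
  split=> /=.
  + by rewrite path_all_leq s1; apply: sub_all s2' => z /ltnW.
  + by rewrite ka; apply: sub_all s2' => z; apply: ltn_trans.
  + move=> z; case: (eqVneq a z) => [<-|_]; last exact: s3.
    by rewrite count_memC.
  + move=> _; rewrite (count_memC (s := parts bs)) ?addn0; first by case: eqP.
    by apply: sub_all s2' => z; apply: leq_ltn_trans.
Qed.

Lemma blocks_cons2 a b s : blocks [:: a, b & s] =
  if (b == a) || (b == a.+1) then inl (a, b) :: blocks s
  else inr a :: blocks (b :: s).
Proof. by []. Qed.

Lemma validK k o bs : valid k o bs -> blocks (parts bs) = bs.
Proof.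
elim: bs k o => [|b bs IH] k o //; rewrite parts_cons; case: b => [[x y]|a] /=.
  by case/and4P => _ yx _ /IH e; rewrite blocks_cons2 yx e.
case/andP => _ v; have [_ s2 _ _] := valid_follows v.
have e := IH _ _ v; move: s2 e.
case: (parts bs) => [|z s]; first by move=> _ <-.
case/andP => az _ e; rewrite blocks_cons2 e.
by have -> : (z == a) || (z == a.+1) = false by lia.
Qed.

Lemma blocksK s : parts (blocks s) = s.
Proof.
have [n le] := ubnP (size s); elim: n s le => // n IH [|a [|b s]] // le.
rewrite blocks_cons2; case: ifP => _; rewrite parts_cons IH //; exact: ltnW.
Qed.

Lemma follows_valid k o s : follows k o s -> valid k o (blocks s).
Proof.
have [n le] := ubnP (size s); elim: n s k o le => // n IH [|a [|b s]] k o // le.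
  by case=> _ /andP[/= -> _].
rewrite blocks_cons2; case=> s1 s2 s3 s4; have /= /and3P[ka kb {}s2] := s2.
move: s1 => /= /andP[ab]; rewrite path_all_leq => /andP[s1 bs].
case: ifP => e; last first.
  have ab' : a.+1 < b by lia.
  rewrite valid_single ka andTb.
  apply: IH => //; split=> //.
  - by rewrite /= path_all_leq s1.
  - by rewrite /= ab' ; apply: sub_all bs => z; apply: leq_trans.
  - by move=> x; have /= := s3 x; lia.
rewrite /= ka e /=; apply/andP; split.
  apply/negP => /andP[/s4 /= c1 /eqP bk]; subst b.
  have ak : a = k.+1 by apply/eqP; rewrite eqn_leq ab ka.
  by move: c1; rewrite ak !eqxx.
apply: IH; first exact: ltnW.
split=> //.
- case/orP: e => /eqP e; subst b; last exact: bs.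
  apply/allP => z zs; rewrite ltn_neqAle (allP bs) // andbT.
  apply/eqP => za; subst z; have : 0 < count_mem a s by rewrite -has_count has_pred1.
  by have := s3 a; rewrite /= !eqxx; case: count.
- by move=> x; apply: leq_trans (s3 x); rewrite /= addnA leq_addl.
- move=> ba; move: e (s3 a.+1); rewrite (negPf ba) /= => /eqP ->.
  by rewrite eqxx (ltn_eqF (ltnSn a)).
Qed.

(** * Where a backward move is possible *)

(** The part of a word of blocks that matters for what follows: a state
    (k, o, ss) records the last pair [k, k+o] and the singletons ss after it. *)
Definition state : Type := nat * bool * seq nat.

Definition step (st : state) (b : block) : state :=
  match b with
  | inl (x, y) => (x, y != x, [::])
  | inr a => (st.1, rcons st.2 a)
  end.

Definition run (st : state) (bs : seq block) : state := foldl step st bs.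

Definition start : state := (0, false, [::]).

(** The arguments of [valid] for the blocks that follow a prefix with the given
    state. *)
Definition bound (st : state) : nat * bool :=
  if st.2 is a :: ss then ((last a ss).+1, false) else st.1.

Lemma valid_cons st b bs :
  valid (bound st).1 (bound st).2 (b :: bs) =
  valid (bound st).1 (bound st).2 [:: b] &&
  valid (bound (step st b)).1 (bound (step st b)).2 bs.
Proof.
case: b => [[x y]|a] /=; first by rewrite andbT !andbA.
have -> : bound (st.1, rcons st.2 a) = (a.+1, false).
  by rewrite /bound /=; case: st.2 => [|c ss] //=; rewrite last_rcons.
by rewrite andbT.
Qed.

Lemma valid_cat st l r :
  valid (bound st).1 (bound st).2 (l ++ r) =
  valid (bound st).1 (bound st).2 l &&
  valid (bound (run st l)).1 (bound (run st l)).2 r.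
Proof.
elim: l st => [|b l IH] st //.
by rewrite cat_cons valid_cons IH andbA -valid_cons.
Qed.

Lemma run_rcons st l b : run st (rcons l b) = step (run st l) b.
Proof. by rewrite /run foldl_rcons. Qed.

Lemma pairs_cat l r : pairs (l ++ r) = pairs l ++ pairs r.
Proof. exact: pmap_cat. Qed.

(** What a prefix l with state (k, o, ss) looks like from the right.  The
    multiplicity of k is bounded below only for a pair [k, k]: there it makes a
    move onto k create a third copy. *)
Definition prefix_spec (l : seq block) (k : nat) (o : bool) (ss : seq nat) :=
  [/\ if rev (pairs l) is p :: _ then p = (k, k + o) else (k, o) = (0, false),
      forall z, k < z ->
        count_mem z (parts l) = (o && (z == k.+1)) + (z \in ss),
      ~~ o -> 0 < k -> 2 <= count_mem k (parts l),
      uniq ss &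
      k <= (bound (k, o, ss)).1 /\
      all (fun z => k < z < (bound (k, o, ss)).1) ss].

Lemma run_spec l : valid 0 false l ->
  prefix_spec l (run start l).1.1 (run start l).1.2 (run start l).2.
Proof.
elim/last_ind: l => [|l b IH]; first by split.
rewrite -cats1 (valid_cat start) cats1 run_rcons => /andP[/IH{IH}].
case: (run start l) => [[k o] ss] /= [s1 s2 s3 s4 [s5 s6]].
rewrite -cats1 /prefix_spec parts_cat pairs_cat rev_cat.
case: b => [[x y]|a].
- case/and4P => kx yx _ _; split=> //=.
  + by case/orP: yx => /eqP ->; rewrite ?eqxx ?addn0 // (gtn_eqF (ltnSn x)) addn1.
  + move=> z xz; rewrite count_cat s2; last by lia.
    have -> : (z \in ss) = false.
      apply/negP => /(allP s6); lia.
    have -> : (z == k.+1) = false by lia.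
    rewrite andbF /= (ltn_eqF xz) !addn0.
    case/orP: yx => /eqP ->; first by rewrite eqxx (ltn_eqF xz).
    by rewrite (gtn_eqF (ltnSn x)) eq_sym.
  + by rewrite negbK => /eqP -> _; rewrite count_cat /= eqxx leq_addl.
- case/andP => ka _; rewrite /step.
  set B := (bound (k, o, ss)).1 in s5 s6 ka.
  have aB : (bound (k, o, rcons ss a)).1 = a.+1.
    by rewrite /bound /=; case: (ss) => [|c t] //=; rewrite last_rcons.
  have ass : a \notin ss by apply/negP => /(allP s6); lia.
  split=> //=.
  + move=> z kz; rewrite count_cat s2 //= mem_rcons inE addn0 -addnA; congr (_ + _).
    rewrite eq_sym.
    by case: (eqVneq z a) => [->|_]; rewrite ?(negPf ass) ?addn0.
  + by move=> o0 k0; rewrite count_cat; apply: leq_trans (leq_addr _ _); apply: s3.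
  + by rewrite rcons_uniq ass.
  + rewrite aB all_rcons; split; first by lia.
    apply/andP; split; first by lia.
    by apply: sub_all s6 => z; lia.
Qed.

(** A moved pair must not start below the preceding one, and must not create a
    third copy of a part.  The second can only happen for the part k, if the
    preceding pair is [k, k], or for k+1, if it is [k, k+1] and k+1 occurs
    again either in the moved pair or as a singleton. *)
Definition blocked (st : state) (p : nat * nat) : bool :=
  let k := st.1.1 in let: (x, y) := move_pair p in
  (x <= k) || [&& st.1.2, x == k.+1 & (y == k.+1) || (k.+1 \in st.2)].

Lemma at_most_twice_moveP l r p :
  reflect (forall z, count_mem z (parts l) +
     count_mem z [:: (move_pair p).1; (move_pair p).2] +
     count_mem z (parts r) <= 2)
  (at_most_twice (move_result l r p)).
Proof.
apply: (iffP (at_most_twiceP _)) => H z; move: (H z);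
  by rewrite /move_result count_sort -/(parts _) parts_cat parts_cons !count_cat addnA.
Qed.

(** The blocks after the pair and those before the preceding pair are
    irrelevant: the moved parts are smaller than the former and, if the moved
    pair does not pass the preceding one, larger than the latter.  When there
    is no preceding pair, k = 0 and the condition expresses that the moved parts
    are positive. *)
Lemma move_possible_local l p r : valid 0 false (l ++ inl p :: r) ->
  move_possible l r p = ~~ blocked (run start l) p.
Proof.
move=> v; have [_ _ tw _] := valid_follows v.
have [_ pos _ _] := valid_follows v.
move: v; rewrite (valid_cat start) => /andP[/run_spec].
case: (run start l) => [[k o] ss]; case: p tw pos => x y tw pos.
move=> /= [s1 s2 s3 s4 [s5 s6]] /and4P[Bx yx noy /valid_follows[_ r1 _ _]].
have sx z : z \in ss -> k < z /\ z.+1 < x by move=> /(allP s6); lia.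
have cr z : z <= x -> count_mem z (parts r) = 0.
  by move=> zx; apply: count_memC; apply: sub_all r1 => w; apply: leq_ltn_trans.
move: tw pos; rewrite parts_cat parts_cons all_cat => tw /and3P[posl _ posr].
have {posr} posr : all (fun z => 0 < z) (parts r).
  by apply: sub_all r1 => z; apply: leq_trans.
rewrite /move_possible /blocked /=.
have : (move_pair (x, y)).1 < x /\ (move_pair (x, y)).2 = x.-1.
  have x0 : 0 < x by apply: leq_ltn_trans Bx.
  by rewrite /move_pair /=; case: ifP => _ /=; rewrite subn1; lia.
have : (move_pair (x, y)).1 = x - 2 \/ (move_pair (x, y)).1 = x - 1.
  by rewrite /move_pair /=; case: ifP => _; [left|right].
have := at_most_twice_moveP l r (x, y).
have : is_partition (move_result l r (x, y)) = (0 < (move_pair (x, y)).1) && (0 < (move_pair (x, y)).2).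
  rewrite /is_partition /move_result sort_sorted; last exact: leq_total.
  by rewrite all_sort -/(parts _) parts_cat parts_cons !all_cat posl posr /= !andbT.
case: (move_pair (x, y)) => m1 m2 /= -> mtw.
move=> m1x [m1lt m2E]; apply/idP/negP.
- case/and3P => /andP[m1pos m2pos] /mtw {}mtw mprev /orP[m1k|].
    (* As the pair did not pass the preceding one, m1 = k, and this would be
       a third part k. *)
    have k0 : 0 < k by lia.
    have m1kE : ~~ o /\ m1 = k.
      move: s1 mprev; case: rev => [[kE _]|p' _ ->] /=; first by lia.
      by case: (o) => ?; split=> //; lia.
    move: (s3 m1kE.1 k0) (mtw k); rewrite m1kE.2 eqxx /=.
    by set c := count_mem k (parts l); lia.
  case/and3P => ot /eqP m1k m2ss.
  have := mtw k.+1; rewrite s2 // m1k ot eqxx /=.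
  by case/orP: m2ss => ->; lia.
- move=> nb; have km1 : k < m1 by rewrite ltnNge; apply/negP => km1; apply: nb; rewrite km1.
  apply/and3P; split; first by lia.
    apply/mtw => z; rewrite addn0.
    have [zm|zm] := boolP ((z == m1) || (z == m2)).
      have [kz zx] : k < z /\ z <= x by clear - zm km1 m1lt m2E; lia.
      rewrite cr ?addn0 ?s2 //.
      move: sx zm km1 m1x m1lt m2E nb; clear=> sx zm km1 m1x m1lt m2E nb.
      move/negP: nb; rewrite negb_or !negb_and !negb_or => /andP[_ nb].
      have [zss|zss] := boolP (z \in ss).
        have [_ z1x] := sx z zss; have zm1 : z = m1 by lia.
        have m2z : (m2 == z) = false by lia.
        subst z; move: nb; rewrite eqxx m2z; case: eqVneq => [<-|_] /=.
          by rewrite zss andbF orbF => /negPf ->.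
        by rewrite andbF.
      rewrite addn0; case: m1x => m1E.
        have m12 : (m1 == m2) = false by lia.
        case: (eqVneq m1 z) => [<-|_]; first by rewrite [m2 == _]eq_sym m12; case: (o && _).
        by case: (o && _); case: (m2 == z).
      have zm1 : z = m1 by lia.
      have m2z : m2 = m1 by lia.
      by move: nb; rewrite zm1 m2z eqxx; case: (m1 == k.+1); case: (o).
    have := tw z; move: zm; clear; rewrite !count_cat /=; lia.
  by move: s1; case: rev => [|p' _] // -> /=; move: km1; clear; case: (o); lia.
Qed.

(** * The base partitions *)

Fixpoint stuck (st : state) (bs : seq block) : bool :=
  if bs is b :: bs' then
    (if b is inl p then blocked st p else true) && stuck (step st b) bs'
  else true.

Definition unmovable_at (bs : seq block) (i : nat) : bool :=
  if nth (inr 0) bs i is inl p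
  then ~~ move_possible (take i bs) (drop i.+1 bs) p else true.

Lemma unmovable_stuck l r : valid 0 false (l ++ r) ->
  all (unmovable_at (l ++ r)) (iota (size l) (size r)) = stuck (run start l) r.
Proof.
elim: r l => [//|b r IH] l v; rewrite [LHS]/= /unmovable_at.
rewrite nth_cat ltnn subnn [nth _ _ _]/= take_size_cat //.
rewrite -cat_rcons drop_size_cat ?size_rcons //.
rewrite [RHS]/= -run_rcons -IH ?cat_rcons // size_rcons; congr (_ && _).
by case: b v => [p|//] v; rewrite move_possible_local // negbK.
Qed.

Lemma no_backward_moveE bs : valid 0 false bs ->
  no_backward_move (parts bs) = stuck start bs.
Proof.
by move=> v; rewrite /no_backward_move (validK v) -(@unmovable_stuck [::]).
Qed.

Lemma last_pair_run bs : (last (0, 0) (pairs bs)).1 = (run start bs).1.1.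
Proof.
elim/last_ind: bs => // bs b IH; rewrite run_rcons -cats1 pairs_cat last_cat.
by case: b => [[x y]|a] //=.
Qed.

Lemma last_pair_end_size bs : last_pair_end bs <= size bs.
Proof. exact: leq_subr. Qed.

Lemma trailing_run bs :
  singletons (drop (last_pair_end bs) bs) = (run start bs).2.
Proof.
elim/last_ind: bs => // bs b IH; rewrite run_rcons.
case: b => [[x y]|a] /=.
  by rewrite /last_pair_end rev_rcons /= subn0 drop_size.
have -> : last_pair_end (rcons bs (inr a)) = last_pair_end bs.
  by rewrite /last_pair_end rev_rcons size_rcons /= subSS.
rewrite drop_rcons ?last_pair_end_size // -IH.
by rewrite /singletons -cats1 pmap_cat /= cats1.
Qed.

Definition stairs (k n : nat) : seq nat := [seq k + i.*2.+1 | i <- iota 0 n].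

Lemma size_stairs k n : size (stairs k n) = n.
Proof. by rewrite size_map size_iota. Qed.

Lemma stairsS k n : stairs k n.+1 = k.+1 :: stairs k.+2 n.
Proof.
rewrite /stairs /= addn1 (iotaDl 1) -map_comp; congr (_ :: _).
by apply: eq_map => i /=; lia.
Qed.

Lemma is_baseE s :
  is_base s = let bs := blocks s in let st := run start bs in
    [&& valid 0 false bs, stuck start bs
      & st.2 == stairs st.1.1 (size st.2)].
Proof.
rewrite /is_base /moveable last_pair_run trailing_run /=.
rewrite andbA; have [/followsP f|nf] := boolP (is_partition s && at_most_twice s).
  by have v := follows_valid f; rewrite v /= -no_backward_moveE // blocksK.
case: (boolP (valid _ _ _)) => [v|//].
by case/negP: nf; apply/followsP; rewrite -[s]blocksK; apply: valid_follows.
Qed.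

(** The singletons before the next pair, and that pair: immobility leaves only
    these possibilities after [k, k+o]. *)
Definition extensions (k : nat) (o : bool) : seq (seq nat * (nat * nat)) :=
  if o then [:: ([::], (k.+1, k.+2)); ([::], (k.+2, k.+2));
                ([::], (k.+2, k.+3)); ([:: k.+1], (k.+3, k.+3))]
  else [:: ([::], (k.+1, k.+1)); ([::], (k.+1, k.+2)); ([::], (k.+2, k.+2))].

Definition single (a : nat) : block := inr a.

Definition extend (e : seq nat * (nat * nat)) (bs : seq block) : seq block :=
  map single e.1 ++ inl e.2 :: bs.

(** After a singleton c > k the next pair starts at c+2 or later, so its move
    starts at c or later; it is blocked only if c = k+1 and the preceding pair
    is [k, k+1].  With two singletons the pair starts at k+5 or later and is
    never blocked. *)
Lemma extensionsP k o e : (e \in extensions k o) =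
  valid k o (extend e [::]) && blocked (k, o, e.1) e.2.
Proof.
have blockedE ss x y : blocked (k, o, ss) (x, y) =
    (x - (if x == y then 2 else 1) <= k) ||
    [&& o, x - (if x == y then 2 else 1) == k.+1
      & (x - 1 == k.+1) || (k.+1 \in ss)].
  by rewrite /blocked /move_pair /=; case: eqP.
case: e => [ss [x y]]; rewrite [(_, _).1]/= [(_, _).2]/= blockedE.
case: ss => [|c [|d ss]].
- rewrite in_nil orbF /extensions; case: o {blockedE};
    rewrite !inE !xpair_eqE /= andbT;
    by case: (eqVneq x y) => [->|xy]; lia.
- rewrite /extensions; case: o {blockedE};
    rewrite !inE !xpair_eqE /= ?eqseq_cons ?andbT /=;
    by case: (eqVneq x y) => [->|xy]; lia.
- have -> : (([:: c, d & ss], (x, y)) \in extensions k o) = false.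
    rewrite /extensions; case: o {blockedE}; rewrite !inE !xpair_eqE //=.
    by rewrite eqseq_cons andbF.
  rewrite /extend /= -/(extend (ss, (x, y)) [::]).
  apply/esym/negbTE/negP => /andP[/and3P[kc cd /valid_follows[_ big _ _]]].
  have : d.+1 < x.
    by move/allP: big; apply; rewrite parts_cat parts_cons mem_cat !inE eqxx orbT.
  by case: ifP; lia.
Qed.

Lemma extend_inj e e' bs bs' :
  extend e bs = extend e' bs' -> e = e' /\ bs = bs'.
Proof.
case: e => ss p; case: e' => ss' p'; rewrite /extend /=.
elim: ss ss' => [|a ss IH] [|a' ss'] //= [].
  by move=> -> ->.
by move=> -> /IH [[-> ->] ->].
Qed.

(** The words that complete a prefix with last pair [k, k+o] to a base
    partition; b counts their pairs and a the moveable singletons. *)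
Fixpoint bases (a b k : nat) (o : bool) : seq (seq block) :=
  if b is b'.+1 then
    [seq extend e bs | e <- extensions k o,
                       bs <- bases a b' e.2.1 (e.2.2 != e.2.1)]
  else [:: map single (stairs k a)].

Lemma run_singles k o ss0 ss :
  run (k, o, ss0) (map single ss) = (k, o, ss0 ++ ss).
Proof.
elim: ss ss0 => [|c ss IH] ss0; first by rewrite cats0.
by rewrite -cat_rcons -IH.
Qed.

Lemma stuck_cat st l r : stuck st (l ++ r) = stuck st l && stuck (run st l) r.
Proof. by elim: l st => [|b l IH] st //=; rewrite IH andbA. Qed.

Lemma stuck_singles st ss : stuck st (map single ss).
Proof. by elim: ss st => /=. Qed.

Lemma run_cat st l r : run st (l ++ r) = run (run st l) r.
Proof. exact: foldl_cat. Qed.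

Lemma run_extend k o e :
  run (k, o, [::]) (extend e [::]) = (e.2.1, e.2.2 != e.2.1, [::]).
Proof. by rewrite run_cat run_singles; case: e => ss []. Qed.

Lemma stuck_extend k o e :
  stuck (k, o, [::]) (extend e [::]) = blocked (k, o, e.1) e.2.
Proof. by rewrite stuck_cat stuck_singles run_singles /= andbT. Qed.

Lemma valid_stairs k o n : valid k o (map single (stairs k n)).
Proof.
elim: n k o => [|n IH] k o //.
by rewrite stairsS /= ltnSn IH.
Qed.

Lemma pairs_singles ss : pairs (map single ss) = [::].
Proof. by elim: ss. Qed.

Lemma pairs_extend e : size (pairs (extend e [::])) = 1.
Proof. by rewrite pairs_cat pairs_singles. Qed.

Lemma split_first_pair bs :
  bs = map single (singletons bs) \/ exists e bs', bs = extend e bs'.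
Proof.
elim: bs => [|[p|a] bs IH]; first by left.
  by right; exists ([::], p), bs.
case: IH => [{1}->|[[ss p] [bs' ->]]]; first by left.
by right; exists (a :: ss, p), bs'.
Qed.

Lemma basesP a b k o bs : (bs \in bases a b k o) =
  let st := run (k, o, [::]) bs in
  [&& valid k o bs, stuck (k, o, [::]) bs, size (pairs bs) == b
    & st.2 == stairs st.1.1 a].
Proof.
elim: b k o bs => [|b IH] k o bs /=.
  rewrite inE; have [->|[e [bs' ->]]] := split_first_pair bs; last first.
    rewrite {2}/extend pairs_cat size_cat addnS andbF andbF.
    apply/eqP => /(congr1 pairs); rewrite pairs_singles /extend pairs_cat.
    by move/(congr1 size); rewrite size_cat addnS.
  rewrite run_singles stuck_singles pairs_singles cat0s !eqxx /=.
  have single_inj : injective single by move=> x y [].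
  apply/eqP/andP => [/(inj_map single_inj) ->|[_ /eqP -> //]].
  by rewrite valid_stairs eqxx.
have [->|[e [bs' ->]]] := split_first_pair bs.
  rewrite pairs_singles /= andbF andbF; apply/negP => /allpairsPdep.
  case=> e [bs' [_ _ /(congr1 pairs)]]; rewrite pairs_singles pairs_cat.
  by move/(congr1 size); rewrite size_cat addnS.
have -> : (extend e bs' \in [seq extend e bs | e <- extensions k o,
    bs <- bases a b e.2.1 (e.2.2 != e.2.1)]) =
  (e \in extensions k o) && (bs' \in bases a b e.2.1 (e.2.2 != e.2.1)).
  apply/allpairsPdep/andP => [[e1 [bs1 [h1 h2 /extend_inj[-> ->]]]]|[h1 h2]].
    by [].
  by exists e, bs'.
rewrite extensionsP IH /=.
have -> : extend e bs' = extend e [::] ++ bs' by rewrite /extend -catA.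
rewrite (@valid_cat (k, o, [::]) (extend e [::])) stuck_cat pairs_cat run_cat size_cat.
rewrite run_extend stuck_extend pairs_extend add1n eqSS.
by case: (blocked _ _); rewrite ?andbF ?andbT //= andbA.
Qed.

Lemma bases_uniq a b k o : uniq (bases a b k o).
Proof.
elim: b k o => [|b IH] k o //=.
apply: allpairs_uniq_dep => //.
  by rewrite /extensions; case: o; rewrite /= !inE !xpair_eqE /=; lia.
by move=> [e bs] [e' bs'] _ _ /= /extend_inj[-> ->].
Qed.

Lemma size_parts bs :
  size (parts bs) = 2 * size (pairs bs) + size (singletons bs).
Proof.
elim: bs => [|[p|c] bs IH] //; rewrite parts_cons size_cat IH /=; lia.
Qed.

(** The exponent of t is the number of parts. *)
Lemma size_base (s : base_partition) : 2 * n2 s + n1 s = size (val s).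
Proof.
rewrite -[X in _ = size X]blocksK size_parts; congr (_ + _).
by rewrite /n1 /n11 /n12 -size_cat -pmap_cat cat_take_drop.
Qed.

Lemma moveable_run s : moveable s = (run start (blocks s)).2.
Proof. exact: trailing_run. Qed.

Lemma mem_bases s a b : (blocks s \in bases a b 0 false) =
  [&& is_base s, size (pairs (blocks s)) == b & size (moveable s) == a].
Proof.
rewrite basesP is_baseE moveable_run /=.
case: (valid _ _ _) => //=; case: (stuck _ _) => //=.
case: (run _ _) => [[k o] ss] /=; rewrite andbCA; congr (_ && _).
apply/eqP/andP => [e|[/eqP e /eqP <- //]].
by rewrite e size_stairs !eqxx.
Qed.

(** * A recurrence for h *)

Definition twice_partition (n m : nat) (s : seq nat) : bool :=
  [&& is_partition s, at_most_twice s, weight s == n & size s == m].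

Lemma weight_ge n s x : weight s = n -> x \in s -> x <= n.
Proof.
by move=> <-; elim: s => //= y s IH; rewrite /weight inE => /orP[/eqP ->|/IH];
  rewrite /weight; lia.
Qed.

(** The partitions counted by h, as plain sequences, so that they can be
    compared for different n and m. *)
Definition twice_enum (n m : nat) : seq (seq nat) :=
  [seq [seq val a | a <- (p : m.-tuple 'I_n.+1)] | p <- enum
    [set p : m.-tuple 'I_n.+1 | let s := [seq val a | a <- p] in
      [&& is_partition s, at_most_twice s & weight s == n]]].

Lemma twice_enum_uniq n m : uniq (twice_enum n m).
Proof.
rewrite map_inj_uniq ?enum_uniq // => p p' /inj_map e.
by apply: val_inj; apply: e; apply: val_inj.
Qed.

Lemma size_twice_enum n m : size (twice_enum n m) = h n m.
Proof. by rewrite size_map -cardE. Qed.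

Lemma mem_twice_enum n m : twice_enum n m =i twice_partition n m.
Proof.
move=> s; rewrite unfold_in; apply/mapP/idP.
  case=> p; rewrite mem_enum inE => /and3P[h1 h2 h3] ->.
  by apply/and4P; split; rewrite // size_map size_tuple.
case/and4P => h1 h2 /eqP h3 /eqP h4.
have sz : size (map (@inord n) s) == m by rewrite size_map h4.
have e : [seq val a | a <- Tuple sz] = s.
  rewrite /= -map_comp map_id_in // => x xs /=.
  by rewrite inordK // ltnS (weight_ge h3).
by exists (Tuple sz); rewrite // mem_enum inE /= e h1 h2 h3 eqxx.
Qed.

Lemma h_size n m L : uniq L -> L =i twice_partition n m -> h n m = size L.
Proof.
move=> uL mL; rewrite -size_twice_enum; apply: perm_size.
by apply: uniq_perm; rewrite ?twice_enum_uniq // => s; rewrite mL mem_twice_enum.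
Qed.

Lemma h_no_parts n : h n 0 = (n == 0).
Proof.
case: eqP => [->|n0].
  rewrite (@h_size 0 0 [:: [::]]) // => s; rewrite inE unfold_in /twice_partition.
  by case: s => [|a s]; rewrite /= ?andbF.
rewrite (@h_size n 0 [::]) // => -[|a s]; rewrite unfold_in /twice_partition.
  by case: n n0.
by apply/esym/negbTE/negP => /and4P[].
Qed.

Lemma weight_ge_size s : is_partition s -> size s <= weight s.
Proof.
case/andP => _; elim: s => //= a s IH /andP[a0 /IH]; rewrite /weight /=; lia.
Qed.

Lemma h_small n m : n < m -> h n m = 0.
Proof.
move=> nm; rewrite (@h_size n m [::]) // => s; rewrite unfold_in.
apply/esym/negbTE/negP => /and4P[/weight_ge_size le _ /eqP e1 /eqP e2].
by move: le; rewrite e1 e2 leqNgt nm.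
Qed.

(** What subtracting 1 from every part of a partition leaves. *)
Definition weak_twice (n m : nat) (s : seq nat) : bool :=
  [&& sorted leq s, at_most_twice s, weight s == n & size s == m].

Lemma twice_partition_succ n m s :
  twice_partition (n + m) m (map succn s) = weak_twice n m s.
Proof.
have aS : all (fun a => 0 < a) (map succn s) by elim: s.
have w : weight (map succn s) = weight s + size s.
  by rewrite /weight; elim: s {aS} => //= a s ->; lia.
have c : at_most_twice (map succn s) = at_most_twice s.
  by rewrite /at_most_twice all_map; apply: eq_all => x /=; rewrite count_map.
rewrite /twice_partition /weak_twice /is_partition aS andbT sorted_map c w size_map.
rewrite (eq_sorted (e' := leq)) //.
by case: (eqVneq (size s) m) => [->|]; rewrite ?eqn_add2r ?andbF.
Qed.

Lemma at_most_twice_zeros j t : all (fun a => 0 < a) t ->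
  at_most_twice (nseq j 0 ++ t) = (j <= 2) && at_most_twice t.
Proof.
move=> t0; have c0 : count_mem 0 t = 0 by apply: count_memC.
have cE x : count_mem x (nseq j 0 ++ t) = (x == 0) * j + count_mem x t.
  by rewrite count_cat count_nseq /= eq_sym.
apply/at_most_twiceP/andP => [H|[j2 /at_most_twiceP H] x].
  split; first by have := H 0; rewrite cE c0 eqxx mul1n addn0.
  by apply/at_most_twiceP => x; apply: leq_trans (H x); rewrite cE leq_addl.
rewrite cE; case: eqVneq => [->|_]; first by rewrite c0 mul1n addn0.
exact: H.
Qed.

Lemma weak_twice_zeros n m j t : all (fun a => 0 < a) t ->
  weak_twice n m (nseq j 0 ++ t) =
  [&& j <= 2, j <= m & twice_partition n (m - j) t].
Proof.
move=> t0; rewrite /weak_twice /twice_partition /is_partition t0 andbT.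
rewrite at_most_twice_zeros // size_cat size_nseq.
have -> : weight (nseq j 0 ++ t) = weight t.
  by rewrite /weight sumn_cat sumn_nseq mul0n.
have -> : sorted leq (nseq j 0 ++ t) = sorted leq t.
  elim: j => // j IH; rewrite /= path_all_leq IH.
  by rewrite (introT allP) ?andbT.
have -> : (j + size t == m) = (j <= m) && (size t == m - j).
  by apply/eqP/andP => [<-|[jm /eqP ->]]; [rewrite leq_addr addKn|lia].
by case: (j <= 2) (j <= m) => -[]; rewrite ?andbF.
Qed.

Lemma split_zeros t : sorted leq t ->
  exists j t', t = nseq j 0 ++ t' /\ all (fun a => 0 < a) t'.
Proof.
elim: t => [|[|a] t IH]; first by exists 0, [::].
  move=> /path_sorted /IH [j [t' [-> t0]]]; by exists j.+1, t'.
move=> /= /(order_path_min leq_trans) st; exists 0, (a.+1 :: t); split=> //=.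
by apply: sub_all st => z; apply: leq_trans.
Qed.

Lemma zeros_inj j j' t t' :
  all (fun a => 0 < a) t -> all (fun a => 0 < a) t' ->
  nseq j 0 ++ t = nseq j' 0 ++ t' -> j = j' /\ t = t'.
Proof.
elim: j j' => [|j IH] [|j'] //=.
- by move=> + _ tE; rewrite tE.
- by move=> _ + tE; rewrite -tE.
- by move=> t0 t0' [/(IH _ t0 t0')[-> ->]].
Qed.

(** Subtracting 1 from each of the m parts of a partition of n+m leaves a
    partition of n preceded by at most two zeros. *)
Lemma h_rec n m : h (n + m) m =
  h n m + (if 0 < m then h n m.-1 else 0) + (if 1 < m then h n m.-2 else 0).
Proof.
pose F j := if j <= m then twice_enum n (m - j) else [::].
pose L := [seq nseq j 0 ++ t | j <- iota 0 3, t <- F j].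
have memF j t : (t \in F j) = (j <= m) && twice_partition n (m - j) t.
  by rewrite /F; case: ifP => // jm; rewrite mem_twice_enum.
have posF j t : t \in F j -> all (fun a => 0 < a) t.
  by rewrite memF => /andP[_ /and4P[/andP[]]].
have sizeF j : size (F j) = if j <= m then h n (m - j) else 0.
  by rewrite /F; case: ifP => // _; rewrite size_twice_enum.
rewrite (@h_size _ _ (map (map succn) L)).
- by rewrite size_map size_allpairs_dep /= !sizeF subn0 subn1 subn2 addn0 addnA.
- rewrite map_inj_uniq; last by apply: inj_map => x y [].
  apply: allpairs_uniq_dep => // [j _|[j t] [j' t']].
    by rewrite /F; case: ifP => // _; apply: twice_enum_uniq.
  case/allpairsPdep => ? [? [_ /posF p1 [-> ->]]].
  case/allpairsPdep => ? [? [_ /posF p2 [-> ->]]].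
  by move=> /= /(zeros_inj p1 p2)[-> ->].
- move=> s; rewrite -[RHS]/(twice_partition _ _ s); apply/mapP/idP.
    case=> t /allpairsPdep[j [t' [j3 t'F ->]]] ->.
    rewrite twice_partition_succ weak_twice_zeros ?(posF j) //.
    by move: j3 t'F; rewrite mem_iota add0n ltnS memF => /= -> ->.
  move=> ds; have [s1 _ _ _] := and4P ds.
  have sE : map succn (map predn s) = s.
    rewrite -map_comp map_id_in // => x xs /=.
    by rewrite prednK //; case/andP: s1 => _ /allP; apply.
  exists (map predn s) => //; move: ds.
  rewrite -{1}sE twice_partition_succ => w.
  have [j [t [tE t0]]] := split_zeros (proj1 (andP w)).
  move: w; rewrite tE weak_twice_zeros // => /andP[j2 w].
  by apply/allpairsPdep; exists j, t; rewrite memF w mem_iota.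
Qed.

(** * Recurrences for the generating functions of base partitions *)

Local Open Scope ring_scope.

Definition extension_parts (e : seq nat * (nat * nat)) : seq nat :=
  rcons (rcons e.1 e.2.1) e.2.2.

(** The identities are consequences of the form of [extensions] and of the
    recurrence satisfied by the contribution r of the moveable singletons. *)
Section Recurrences.

Variables (R : comUnitRingType) (q t : R) (r : nat -> R).

Definition monomial (s : seq nat) : R := t ^+ size s * q ^+ weight s.

(** E_b(k) for o = false and O_b(k) for o = true.  The factors 1 - q^(3i) for
    i = 1, ..., b make up (q^3;q^3)_b. *)
Fixpoint base_gf (b : nat) (o : bool) (k : nat) : R :=
  if b is b'.+1 then
    (\sum_(e <- extensions k o) monomial (extension_parts e) *
       base_gf b' (e.2.2 != e.2.1) e.2.1) / (1 - q ^+ (3 * b))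
  else r k.

Definition tq (k : nat) : R := t * q ^+ k.

Lemma tqS k : tq k.+1 = tq k * q.
Proof. by rewrite /tq exprSr mulrA. Qed.

Hypothesis unit_q : forall k, 1 - q ^+ k.+1 \is a GRing.unit.
Hypothesis r_rec : forall k, r k = r k.+1 + tq k * q * r k.+2.

Lemma monomial_cons a s : monomial (a :: s) = tq a * monomial s.
Proof. by rewrite /monomial /tq exprS /weight /= exprD; ring. Qed.

Lemma monomial_nil : monomial [::] = 1.
Proof. by rewrite /monomial mulr1. Qed.

Let monE := (monomial_cons, monomial_nil, tqS).

Lemma base_gf_even b k :
  (1 - q ^+ (3 * b) * q ^+ 3) * base_gf b.+1 false k =
  tq k ^+ 2 * (q ^+ 2 * base_gf b false k.+1 + q ^+ 3 * base_gf b true k.+1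
    + q ^+ 4 * base_gf b false k.+2).
Proof.
rewrite -exprD addnC -mulnS mulrC /= divrK; last exact: unit_q.
rewrite !big_cons big_nil /= !eqxx !(gtn_eqF (ltnSn _)) /= !monE.
ring.
Qed.

Lemma base_gf_odd b k :
  (1 - q ^+ (3 * b) * q ^+ 3) * base_gf b.+1 true k =
  tq k ^+ 2 * (q ^+ 3 * base_gf b true k.+1 + q ^+ 4 * base_gf b false k.+2
    + q ^+ 5 * base_gf b true k.+2 + tq k * q ^+ 7 * base_gf b false k.+3).
Proof.
rewrite -exprD addnC -mulnS mulrC /= divrK; last exact: unit_q.
rewrite !big_cons big_nil /= !eqxx !(gtn_eqF (ltnSn _)) /= !monE.
ring.
Qed.

(** For b = 0 both identities are instances of the recurrence of r.  In the
    inductive step, multiplying by 1 - q^(3b+3) expresses both sides by the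
    functions for b; the induction hypotheses absorb the factor q^(3b), and the
    two sides then agree term by term.  The recursions mix E_b and O_b, so the
    two identities go together. *)
Lemma pairs_shift b :
  (forall k, q ^+ (3 * b) * base_gf b false k =
     base_gf b true k.+1 + tq k * q * base_gf b false k.+2) /\
  (forall k, q ^+ (3 * b) * base_gf b true k =
     base_gf b false k.+2 + tq k * q * base_gf b true k.+2
     + tq k * q ^+ 2 * base_gf b false k.+3).
Proof.
elim: b => [|b [IH0 IH1]].
  split=> k; rewrite expr0 mul1r /=; first exact: r_rec.
  by rewrite r_rec [r k.+1]r_rec tqS; ring.
have u : 1 - q ^+ (3 * b) * q ^+ 3 \is a GRing.unit.
  by rewrite -exprD addnC -mulnS; apply: unit_q.
have QE : q ^+ (3 * b.+1) = q ^+ (3 * b) * q ^+ 3 by rewrite -exprD addnC -mulnS.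
move: (base_gf_even b) (base_gf_odd b) IH0 IH1 u; rewrite QE.
move: (q ^+ (3 * b)) => Q; move: (base_gf b.+1) (base_gf b) => F f He Ho H0 H1 u.
split=> k; apply: (mulrI u).
- rewrite mulrCA He [in RHS]mulrDr Ho [X in _ = _ + X]mulrCA He !tqS.
  have -> : Q * q ^+ 3 * (tq k ^+ 2 * (q ^+ 2 * f false k.+1
      + q ^+ 3 * f true k.+1 + q ^+ 4 * f false k.+2)) =
    q ^+ 5 * tq k ^+ 2 * (Q * f false k.+1 + q * (Q * f true k.+1)
      + q ^+ 2 * (Q * f false k.+2)) by ring.
  by rewrite !H0 H1 !tqS; ring.
- rewrite mulrCA Ho 2![in RHS]mulrDr He.
  rewrite [X in _ = _ + X + _]mulrCA [X in _ = _ + X]mulrCA Ho He !tqS.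
  have -> : Q * q ^+ 3 * (tq k ^+ 2 * (q ^+ 3 * f true k.+1
      + q ^+ 4 * f false k.+2 + q ^+ 5 * f true k.+2
      + tq k * q ^+ 7 * f false k.+3)) =
    q ^+ 6 * tq k ^+ 2 * (Q * f true k.+1 + q * (Q * f false k.+2)
      + q ^+ 2 * (Q * f true k.+2) + tq k * q ^+ 4 * (Q * f false k.+3)) by ring.
  by rewrite !H0 !H1 !tqS; ring.
Qed.

Lemma base_gf_dilate (d : {rmorphism R -> R}) : d q = q -> d t = t * q ->
  (forall k, d (r k) = r k.+1) -> forall b o k, d (base_gf b o k) = base_gf b o k.+1.
Proof.
move=> dq dt dr b o k; elim: b o k => [|b IH] o k; first exact: dr.
have u : 1 - q ^+ (3 * b) * q ^+ 3 \is a GRing.unit.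
  by rewrite -exprD addnC -mulnS; apply: unit_q.
apply: (mulrI u).
have {1}<- : d (1 - q ^+ (3 * b) * q ^+ 3) = 1 - q ^+ (3 * b) * q ^+ 3.
  by rewrite rmorphB rmorph1 rmorphM !rmorphXn /= dq.
rewrite -rmorphM; case: o; rewrite ?base_gf_odd ?base_gf_even.
  by rewrite /tq !(rmorphM, rmorphD, rmorphXn) /= dq dt !IH (exprS q k) !mulrA.
by rewrite /tq !(rmorphM, rmorphD, rmorphXn) /= dq dt !IH (exprS q k) !mulrA.
Qed.

(** E_(b-1)(k) and O_(b-1)(k), with value 0 for b = 0, so that the next
    recurrences hold for all b. *)
Definition base_gf_pred (b : nat) (o : bool) (k : nat) : R :=
  if b is b'.+1 then base_gf b' o k else 0.

(** For arbitrary partitions, those that can follow [k, k] but not [k, k+1] are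
    those that start with the pair [k+1, k+1].  Base partitions do not have this
    property, but their generating functions do. *)
Lemma base_gf_oddE b k :
  base_gf b true k = base_gf b false k - tq k ^+ 2 * q ^+ 2 * base_gf_pred b false k.+1.
Proof.
case: b => [|b]; first by rewrite mulr0 subr0.
have u : 1 - q ^+ (3 * b) * q ^+ 3 \is a GRing.unit.
  by rewrite -exprD addnC -mulnS; apply: unit_q.
apply: (mulrI u); rewrite mulrBr base_gf_even base_gf_odd /=.
have -> : (1 - q ^+ (3 * b) * q ^+ 3) * (tq k ^+ 2 * q ^+ 2 * base_gf b false k.+1)
  = tq k ^+ 2 * q ^+ 2 * base_gf b false k.+1
    - tq k ^+ 2 * q ^+ 5 * (q ^+ (3 * b) * base_gf b false k.+1) by ring.
by rewrite (pairs_shift b).1 !tqS; ring.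
Qed.

(** The first identity of [pairs_shift] replaces the term q^(3b) E_b(k) on the
    left of [base_gf_even]; [base_gf_oddE] then eliminates O.  The coefficients
    no longer depend on b. *)
Lemma base_gf_rec b k : base_gf b false k =
  base_gf b false k.+1 + tq k * q * base_gf b false k.+2
  + tq k ^+ 2 * (q ^+ 2 + q ^+ 3) * base_gf_pred b false k.+1
  - tq k ^+ 4 * q ^+ 7 * base_gf_pred b.-1 false k.+2.
Proof.
case: b => [|b]; first by rewrite /= !mulr0 addr0 subr0 -r_rec.
have := base_gf_even b k.
have -> : (1 - q ^+ (3 * b) * q ^+ 3) * base_gf b.+1 false k =
  base_gf b.+1 false k - q ^+ (3 * b.+1) * base_gf b.+1 false k.
  by rewrite mulnS addnC exprD; ring.
move/eqP; rewrite subr_eq => /eqP ->; rewrite (pairs_shift b.+1).1.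
have predS o j : base_gf_pred b.+1 o j = base_gf b o j by [].
by rewrite !base_gf_oddE !predS !tqS [b.+1.-1]/=; ring.
Qed.

Definition partial_gf (n k : nat) : R := \sum_(b < n) base_gf b false k.

(** The failure of S(k) = (1 + T q + T^2 q^2) S(k+1) for the sum S of the
    first n terms. *)
Definition defect (n k : nat) : R :=
  partial_gf n k - (1 + tq k * q + tq k ^+ 2 * q ^+ 2) * partial_gf n k.+1.

(** Summed over all b, [base_gf_rec] is a second-order recurrence for S in k.
    As a difference operator it factors through the one that defines the defect,
    and what is left is a first-order recurrence whose coefficient is a multiple
    of t.  Only the truncation of the sum adds further terms. *)
Lemma defect_rec n k :
  defect n.+2 k = tq k * (q * (tq k * q ^+ 2 - 1) * defect n.+2 k.+1)
    - tq k ^+ 2 * ((q ^+ 2 + q ^+ 3) * base_gf n.+1 false k.+1)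
    + tq k ^+ 4 * (q ^+ 7 * (base_gf n false k.+2 + base_gf n.+1 false k.+2)).
Proof.
have S1 : \sum_(b < n.+2) base_gf_pred b false k.+1 =
    partial_gf n.+2 k.+1 - base_gf n.+1 false k.+1.
  by rewrite big_ord_recl add0r /partial_gf [in RHS]big_ord_recr addrK.
have S2 : \sum_(b < n.+2) base_gf_pred b.-1 false k.+2 =
    partial_gf n.+2 k.+2 - base_gf n.+1 false k.+2 - base_gf n false k.+2.
  rewrite 2!big_ord_recl !add0r /partial_gf 2![in RHS]big_ord_recr /=.
  by rewrite !addrK.
have S0 : partial_gf n.+2 k = partial_gf n.+2 k.+1
    + tq k * q * partial_gf n.+2 k.+2
    + tq k ^+ 2 * (q ^+ 2 + q ^+ 3) *
      (partial_gf n.+2 k.+1 - base_gf n.+1 false k.+1)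
    - tq k ^+ 4 * q ^+ 7 *
      (partial_gf n.+2 k.+2 - base_gf n.+1 false k.+2 - base_gf n false k.+2).
  rewrite -S1 -S2 !mulr_sumr -!big_split -sumrB; apply: eq_bigr => b _ /=.
  exact: base_gf_rec.
by rewrite /defect S0 !tqS; ring.
Qed.

End Recurrences.

(** * Power series in q and t *)

Local Notation q1 := (fpsX int).

(** The contribution of the moveable singletons k+1, k+3, ..., k+2m-1, whose
    sum is m^2 + mk. *)
Definition stairs_gf (k : nat) : fps2 :=
  Fps (fun m => q1 ^+ (m * m + m * k) / qpoch q1 q1 m).

Lemma qpochS (R : nzRingType) (a q : R) n :
  qpoch a q n.+1 = qpoch a q n * (1 - a * q ^+ n).
Proof. exact: big_ord_recr. Qed.

Lemma unitX n : 1 - q1 ^+ n.+1 \is a GRing.unit.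
Proof. by rewrite fps_unitE fcoefD fcoefN fcoef1 fcoefXn subr0 unitr1. Qed.

Lemma unit_qpochX n : qpoch q1 q1 n \is a GRing.unit.
Proof. by apply: rpred_prod => i _; rewrite -exprS unitX. Qed.

Lemma unit_qv k : 1 - qv ^+ k.+1 \is a GRing.unit.
Proof. by have := qpoch_unit k 1; rewrite /qpoch big_ord1 expr0 mulr1; exact. Qed.

Lemma fcoef_qvM n (F : fps2) m : fcoef (qv ^+ n * F) m = q1 ^+ n * fcoef F m.
Proof. by rewrite /qv -rmorphXn fcoefCM. Qed.

Lemma fcoef_tvM n (F : fps2) m :
  fcoef (tv ^+ n * F) m = if (n <= m)%N then fcoef F (m - n) else 0.
Proof.
elim: n m => [|n IH] m; first by rewrite expr0 mul1r subn0.
by rewrite exprS -mulrA fcoefXM; case: m => [|m] //; rewrite IH subSS.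
Qed.

(** The Rogers-Ramanujan recurrence; coefficientwise it says
    1 = q^m + (1 - q^m). *)
Lemma stairs_gf_rec k : stairs_gf k = stairs_gf k.+1 + tq qv tv k * qv * stairs_gf k.+2.
Proof.
apply: fpsP => m; rewrite fcoefD.
have -> : tq qv tv k * qv * stairs_gf k.+2 = tv ^+ 1 * (qv ^+ k.+1 * stairs_gf k.+2).
  by rewrite /tq expr1 exprSr !mulrA.
rewrite fcoef_tvM fcoef_qvM; case: m => [|m]; first by rewrite /= addr0.
rewrite subn1 [m.+1.-1]/= [LHS]/= [fcoef (stairs_gf k.+1) _]/= [fcoef (stairs_gf k.+2) _]/=.
set A := q1 ^+ (m.+1 * m.+1 + m.+1 * k).
have -> : q1 ^+ (m.+1 * m.+1 + m.+1 * k.+1) = A * q1 ^+ m.+1.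
  by rewrite -exprD; congr (_ ^+ _); lia.
have -> : q1 ^+ k.+1 * (q1 ^+ (m * m + m * k.+2) / qpoch q1 q1 m) = A / qpoch q1 q1 m.
  by rewrite mulrA -exprD; congr (_ ^+ _ / _); lia.
apply: (mulIr (unit_qpochX m.+1)).
rewrite mulrDl !divrK ?unit_qpochX // qpochS mulrA divrK ?unit_qpochX //.
by rewrite -exprS mulrBr mulr1 addrC subrK.
Qed.

(** Divisibility by t^N. *)
Definition tdvd (N : nat) (F : fps2) : Prop :=
  forall m, (m < N)%N -> fcoef F m = 0.

Lemma tdvd_le N M F : (N <= M)%N -> tdvd M F -> tdvd N F.
Proof. by move=> NM F0 m mN; apply: F0; apply: leq_trans NM. Qed.

Lemma tdvdD N F G : tdvd N F -> tdvd N G -> tdvd N (F + G).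
Proof. by move=> F0 G0 m mN; rewrite fcoefD F0 ?G0 ?addr0. Qed.

Lemma tdvdN N F : tdvd N F -> tdvd N (- F).
Proof. by move=> F0 m mN; rewrite fcoefN F0 ?oppr0. Qed.

Lemma tdvd_sum N (I : Type) (s : seq I) (F : I -> fps2) :
  (forall i, tdvd N (F i)) -> tdvd N (\sum_(i <- s) F i).
Proof. by move=> F0 m mN; rewrite fcoef_sum big1 // => i _; apply: F0. Qed.

Lemma tdvdMl N F G : tdvd N G -> tdvd N (F * G).
Proof.
move=> G0 m mN; rewrite fcoefM big1 // => i _.
by rewrite G0 ?mulr0 // (leq_ltn_trans (leq_subr _ _)).
Qed.

Lemma tdvd_tvM j N F : tdvd N F -> tdvd (j + N) (tv ^+ j * F).
Proof.
by move=> F0 m mN; rewrite fcoef_tvM; case: leqP => // jm; rewrite F0 ?ltn_subLR.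
Qed.

Lemma tdvd_tqM j k N F : tdvd N F -> tdvd (j + N) (tq qv tv k ^+ j * F).
Proof. by move=> F0; rewrite exprMn -mulrA; apply/tdvd_tvM/tdvdMl. Qed.

(** The substitution of tq for t. *)
Definition dilate (F : fps2) : fps2 := Fps (fun m => q1 ^+ m * fcoef F m).

Fact dilate_additive F G : dilate (F - G) = dilate F - dilate G.
Proof. by apply: fpsP => m /=; rewrite mulrBr. Qed.

Fact dilate_multiplicative : monoid_morphism dilate.
Proof.
split=> [|F G]; apply: fpsP => m; rewrite -[LHS]/(q1 ^+ m * fcoef _ m).
  by rewrite fcoef1; case: eqP => [->|_]; rewrite ?mulr1 ?mulr0.
rewrite fcoefM mulr_sumr; apply: eq_bigr => i _ /=.
by rewrite mulrACA -exprD subnKC // -ltnS.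
Qed.

HB.instance Definition _ := GRing.isZmodMorphism.Build fps2 fps2 dilate
  dilate_additive.
HB.instance Definition _ := GRing.isMonoidMorphism.Build fps2 fps2 dilate
  dilate_multiplicative.

Lemma dilate_qv : dilate qv = qv.
Proof.
apply: fpsP => -[|m]; first by rewrite [LHS]/= mul1r.
by rewrite [LHS]/= mulr0.
Qed.

Lemma dilate_tv : dilate tv = tv * qv.
Proof.
apply: fpsP => m; rewrite mulrC -[qv]expr1 fcoef_qvM /=.
by case: (m =P 1%N) => [->|_]; rewrite ?mulr0.
Qed.

Lemma dilate_stairs_gf k : dilate (stairs_gf k) = stairs_gf k.+1.
Proof.
by apply: fpsP => m /=; rewrite mulrA -exprD; congr (_ ^+ _ / _); lia.
Qed.

Local Notation bgf := (base_gf qv tv stairs_gf).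

Lemma dilate_bgf b o k : dilate (bgf b o k) = bgf b o k.+1.
Proof.
pose d : {rmorphism fps2 -> fps2} := dilate.
exact: (@base_gf_dilate _ _ _ _ unit_qv d dilate_qv dilate_tv dilate_stairs_gf).
Qed.

Lemma tdvd_bgf b o k : tdvd b (bgf b o k).
Proof.
elim: b o k => [|b IH] o k; first by move=> m.
rewrite /= mulrC; apply/tdvdMl/tdvd_sum => e.
have -> : extension_parts e = rcons e.1 e.2.1 ++ [:: e.2.2] by rewrite cats1.
rewrite /monomial size_cat addn1 exprSr [_ * tv]mulrC -2!mulrA -[tv]expr1.
by rewrite -add1n; apply/tdvd_tvM/tdvdMl/tdvdMl.
Qed.

Local Notation partial := (partial_gf qv tv stairs_gf).

(** In [defect_rec] the defect on the right comes with a factor t, and the terms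
    due to truncation are divisible by t^(n+2). *)
Lemma tdvd_defect n k : tdvd n.+2 (defect qv tv stairs_gf n.+2 k).
Proof.
suff H j : (j <= n.+2)%N -> forall k, tdvd j (defect qv tv stairs_gf n.+2 k).
  exact: H.
elim: j => [|j IH] jn {}k; first by move=> m.
rewrite (defect_rec unit_qv stairs_gf_rec); apply: tdvdD; first apply: tdvdD.
- by rewrite -[tq qv tv k]expr1 -add1n; apply/tdvd_tqM/tdvdMl/IH/ltnW.
- apply: tdvdN; apply: (@tdvd_le _ (2 + n.+1)); first exact: leqW jn.
  by apply/tdvd_tqM/tdvdMl/tdvd_bgf.
- apply: (@tdvd_le _ (4 + n)); first exact: leq_trans jn (leq_addl 2 n.+2).
  apply/tdvd_tqM/tdvdMl/tdvdD; first exact: tdvd_bgf.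
  by apply: (tdvd_le _ (@tdvd_bgf n.+1 _ _)).
Qed.

(** The coefficient of t^m in S(0) = (1 + t q + t^2 q^2) S(1), where S(1) is
    S(0) with tq substituted for t. *)
Lemma partial_coef_rec n m (s := fcoef (partial n.+2 0)) : (m < n.+2)%N ->
  s m = q1 ^+ m * (s m + (if (0 < m)%N then s m.-1 else 0)
                       + (if (1 < m)%N then s m.-2 else 0)).
Proof.
move=> mn; have := @tdvd_defect n 0 m mn; rewrite /defect fcoefD fcoefN.
move/eqP; rewrite subr_eq0 => /eqP; rewrite -/(s m) => {1}->.
have -> : (1 + tq qv tv 0 * qv + tq qv tv 0 ^+ 2 * qv ^+ 2) * partial n.+2 1 =
  partial n.+2 1 + tv ^+ 1 * (qv ^+ 1 * partial n.+2 1)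
  + tv ^+ 2 * (qv ^+ 2 * partial n.+2 1).
  by rewrite /tq expr0 mulr1 !mulrDl mul1r !expr1 !mulrA.
have sE j : fcoef (partial n.+2 1) j = q1 ^+ j * s j.
  rewrite /s /partial_gf !fcoef_sum mulr_sumr; apply: eq_bigr => b _.
  by rewrite -dilate_bgf.
rewrite !fcoefD !fcoef_tvM !fcoef_qvM !sE !mulrDr subn1 subn2; congr (_ + _ + _).
  by case: m mn => [|m] _; rewrite ?mulr0 // mulrA -exprD.
by case: m mn => [|[|m]] _; rewrite ?mulr0 // mulrA -exprD.
Qed.

Definition twice_gf (m : nat) : fps int := Fps (fun n => (h n m)%:R).

Lemma fcoef_q1M k (F : fps int) n :
  fcoef (q1 ^+ k * F) n = if (k <= n)%N then fcoef F (n - k) else 0.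
Proof.
elim: k n => [|k IH] n; first by rewrite expr0 mul1r subn0.
by rewrite exprS -mulrA fcoefXM; case: n => [|n] //; rewrite IH subSS.
Qed.

Lemma twice_gf_rec m : twice_gf m =
  q1 ^+ m * (twice_gf m + (if (0 < m)%N then twice_gf m.-1 else 0)
             + (if (1 < m)%N then twice_gf m.-2 else 0)).
Proof.
apply: fpsP => n; rewrite fcoef_q1M; have [mn|mn] := leqP m n; last first.
  by rewrite -[LHS]/((h n m)%:R : int) h_small.
rewrite -[LHS]/((h n m)%:R : int) -[in LHS](subnK mn) h_rec !natrD !fcoefD.
by congr (_ + _ + _); case: ifP => _; rewrite ?fcoef0.
Qed.

(** The common recurrence has the form (1 - q^m) s_m = known terms, and
    1 - q^m is invertible for m > 0. *)
Lemma partial_coef n m : (m < n.+2)%N -> fcoef (partial n.+2 0) m = twice_gf m.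
Proof.
elim/ltn_ind: m => -[|m] IH mn.
  rewrite /partial_gf big_ord_recl fcoefD fcoef_sum big1 => [|b _]; last first.
    exact: (tdvd_bgf (b := b.+1)).
  rewrite addr0 -[LHS]/(1 / qpoch q1 q1 0) /qpoch big_ord0 divr1.
  by apply: fpsP => j; rewrite fcoef1 -[RHS]/((h j 0)%:R : int) h_no_parts.
have isolate (A F x y : fps int) :
    F = A * (F + x + y) -> (1 - A) * F = A * (x + y).
  by move=> e; rewrite mulrBl mul1r {1}e -addrA mulrDr addrAC subrr add0r.
apply: (mulrI (unitX m)); rewrite (isolate _ _ _ _ (partial_coef_rec mn)).
rewrite (isolate _ _ _ _ (twice_gf_rec m.+1)); congr (_ * (_ + _)).
  by rewrite IH // ltnW.
by case: m IH mn => // m IH mn; rewrite IH // ltnW // ltnW.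
Qed.

(** * Summation over the base partitions *)

Definition base_term (a b : nat) (bs : seq block) : fps2 :=
  monomial qv tv (parts bs)
    / (qpoch qv qv a * qpoch (qv ^+ 3) (qv ^+ 3) b).

Definition base_sum (N b : nat) (o : bool) (k : nat) : fps2 :=
  \sum_(a < N) \sum_(bs <- bases a b k o) base_term a b bs.

Lemma monomial_cat s s' :
  monomial qv tv (s ++ s') = monomial qv tv s * monomial qv tv s'.
Proof.
by rewrite /monomial /weight size_cat sumn_cat !exprD mulrACA.
Qed.

Lemma parts_extend e bs : parts (extend e bs) = extension_parts e ++ parts bs.
Proof.
rewrite /extend /extension_parts parts_cat -!cats1 -!catA; congr (_ ++ _).
by elim: e.1 => // a s IH; rewrite map_cons parts_cons IH.
Qed.

Lemma unit_qpoch_qv a : qpoch qv qv a \is a GRing.unit.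
Proof. by have := qpoch_unit 0 a; rewrite expr1. Qed.

Lemma qpoch_qv3S b : qpoch (qv ^+ 3) (qv ^+ 3) b.+1 =
  qpoch (qv ^+ 3) (qv ^+ 3) b * (1 - qv ^+ (3 * b.+1)).
Proof. by rewrite qpochS -exprS -exprM. Qed.

Fact divr_regroup (R : comUnitRingType) (w p x y u : R) :
  x \is a GRing.unit -> y \is a GRing.unit -> u \is a GRing.unit ->
  w * p / (x * (y * u)) = w * (p / (x * y)) / u.
Proof.
move=> xU yU uU; rewrite !invrM ?unitrM ?xU ?yU //.
by rewrite -!mulrA; congr (_ * (_ * _)); rewrite mulrC mulrA.
Qed.

Lemma base_sumS N b o k : base_sum N b.+1 o k =
  (\sum_(e <- extensions k o) monomial qv tv (extension_parts e) *
     base_sum N b (e.2.2 != e.2.1) e.2.1) / (1 - qv ^+ (3 * b.+1)).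
Proof.
transitivity (\sum_(a < N) \sum_(e <- extensions k o)
    \sum_(bs <- bases a b e.2.1 (e.2.2 != e.2.1)) base_term a b.+1 (extend e bs)).
  by apply: eq_bigr => a _; apply: big_allpairs_dep.
rewrite exchange_big mulr_suml; apply: eq_bigr => e _.
rewrite mulr_sumr mulr_suml; apply: eq_bigr => a _.
rewrite mulr_sumr mulr_suml; apply: eq_bigr => bs _.
rewrite /base_term parts_extend monomial_cat qpoch_qv3S.
exact: divr_regroup (unit_qpoch_qv a) (qpoch_unit 2 b) (unit_qv _).
Qed.

Lemma weight_stairs k a : weight (stairs k a) = (a * a + a * k)%N.
Proof.
by elim: a k => // a IH k; rewrite stairsS /weight /= -/(weight _) IH; lia.
Qed.

Lemma parts_singles ss : parts (map single ss) = ss.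
Proof. by elim: ss => // a ss IH; rewrite map_cons parts_cons IH. Qed.

Lemma qpoch_fpsC a : qpoch qv qv a = fpsC (qpoch q1 q1 a).
Proof.
rewrite /qpoch rmorph_prod; apply: eq_bigr => i _.
by rewrite rmorphB rmorph1 rmorphM rmorphXn.
Qed.

(** For b = 0 only a = m contributes to the coefficient of t^m. *)
Lemma tdvd_base_sum N b o k : tdvd N (bgf b o k - base_sum N b o k).
Proof.
elim: b o k => [|b IH] o k.
  move=> m mN; rewrite fcoefD fcoefN; apply/eqP; rewrite subr_eq0; apply/eqP.
  have term a : fcoef (base_term a 0 (map single (stairs k a))) m =
      if m == a then fcoef (stairs_gf k) m else 0.
    rewrite /base_term parts_singles /monomial size_stairs weight_stairs.
    rewrite [qpoch _ _ 0]/qpoch big_ord0 mulr1 qpoch_fpsC -rmorphV ?unit_qpochX //.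
    rewrite -mulrA fcoef_tvM fcoef_qvM fcoefC.
    have [am|am] := leqP a m.
      have -> : (m - a == 0)%N = (m == a).
        by rewrite subn_eq0 eqn_leq am andbT.
      by case: eqP => [->|_]; rewrite ?mulr0.
    by rewrite ltn_eqF.
  have sumE (a : 'I_N) : fcoef (\sum_(bs <- bases a 0 k o) base_term a 0 bs) m =
      if m == a then fcoef (stairs_gf k) m else 0 by rewrite big_seq1 term.
  rewrite /base_sum fcoef_sum (eq_bigr _ (fun a _ => sumE a)).
  rewrite (bigD1 (Ordinal mN)) //= eqxx big1 ?addr0 // => a.
  by rewrite -val_eqE eq_sym => /negPf ->.
rewrite base_sumS /= -mulrBl mulrC; apply: tdvdMl; rewrite -sumrB.
by apply: tdvd_sum => e; rewrite -mulrBr; apply/tdvdMl/IH.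
Qed.

Lemma basesE a b bs : bs \in bases a b 0 false ->
  [/\ blocks (parts bs) = bs, is_base (parts bs), size (pairs bs) = b
    & size (moveable (parts bs)) = a].
Proof.
move=> bsB; have v : valid 0 false bs by move: bsB; rewrite basesP => /and4P[].
have bK := validK v; split=> //; move: bsB; rewrite -{1}bK mem_bases bK;
  by case/and3P => // ? /eqP ? /eqP.
Qed.

(** All base partitions with fewer than N pairs and fewer than N moveable
    singletons; they contain all those that contribute to t^m for m < N. *)
Definition bases_upto (N : nat) : seq (seq nat) :=
  [seq parts bs | bs <- [seq bs | p <- [seq (b, a) | b <- iota 0 N, a <- iota 0 N],
                                  bs <- bases p.2 p.1 0 false]].

Lemma mem_bases_upto N s : (s \in bases_upto N) =
  [&& is_base s, (size (pairs (blocks s)) < N)%N & (size (moveable s) < N)%N].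
Proof.
apply/mapP/and3P => [[bs /allpairsPdep[[b a] [bs' [pN bsB ->]]] ->]|[sB bN aN]].
  have [-> -> -> ->] := basesE bsB; move: pN.
  by case/allpairsP => -[b' a'] [/= + + [-> ->]]; rewrite !mem_iota.
exists (blocks s); last by rewrite blocksK.
apply/allpairsPdep; exists (size (pairs (blocks s)), size (moveable s)), (blocks s).
split=> //; last by rewrite mem_bases sB !eqxx.
by apply/allpairsP; exists (size (pairs (blocks s)), size (moveable s)); rewrite !mem_iota.
Qed.

Lemma bases_upto_uniq N : uniq (bases_upto N).
Proof.
rewrite map_inj_in_uniq.
  apply: allpairs_uniq_dep => [|p _|u u'].
  - by apply: allpairs_uniq; rewrite ?iota_uniq // => -[b a] [b' a'] _ _ [-> ->].
  - exact: bases_uniq.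
  case/allpairsPdep=> -[b a] [bs [_ /basesE[_ _ /= <- <-] ->]].
  by case/allpairsPdep=> -[b' a'] [bs' [_ /basesE[_ _ /= <- <-] ->]] /= ->.
move=> bs bs' /allpairsPdep[p [x [_ /basesE[xK _ _ _] ->]]].
move=> /allpairsPdep[p' [x' [_ /basesE[xK' _ _ _] ->]]] e.
by rewrite -xK e xK'.
Qed.

Lemma sum_bases_upto (V : nmodType) (F : seq nat -> V) N :
  \sum_(s <- bases_upto N) F s =
  \sum_(b < N) \sum_(a < N) \sum_(bs <- bases a b 0 false) F (parts bs).
Proof.
rewrite big_map big_allpairs_dep big_allpairs -(big_mkord xpredT (fun b =>
  \sum_(a < N) \sum_(bs <- bases a b 0 false) F (parts bs))) /index_iota subn0.
apply: eq_bigr => b _; rewrite -(big_mkord xpredT (fun a =>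
  \sum_(bs <- bases a b 0 false) F (parts bs))) /index_iota subn0.
by [].
Qed.

Theorem theorem3 :
  fps2_has_sum
    (fun b : base_partition =>
       qv ^+ weight (val b) * tv ^+ (2 * n2 b + n1 b)
         / (qpoch qv qv (n12 b) * qpoch (qv ^+ 3) (qv ^+ 3) (n2 b)))
    (series2 (fun n m => (h n m)%:R)).
Proof.
move=> n m; pose G s : fps2 := qv ^+ weight s * tv ^+ size s
  / (qpoch qv qv (size (moveable s)) *
     qpoch (qv ^+ 3) (qv ^+ 3) (size (pairs (blocks s)))).
have termE (i : base_partition) : qv ^+ weight (val i) * tv ^+ (2 * n2 i + n1 i)
    / (qpoch qv qv (n12 i) * qpoch (qv ^+ 3) (qv ^+ 3) (n2 i)) = G (val i).
  by rewrite size_base.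
pose r : seq base_partition := pmap insub (bases_upto m.+2).
have rE : map val r = bases_upto m.+2.
  rewrite (pmap_filter (insubK _)); apply/all_filterP/allP => s.
  by rewrite mem_bases_upto => /and3P[sB _ _]; rewrite /= insubT.
exists r; split.
- exact/pmap_sub_uniq/bases_upto_uniq.
- move=> i; rewrite -(mem_map val_inj) rE mem_bases_upto (valP i) /= => big.
  rewrite termE /G [qv ^+ _ * _]mulrC -mulrA /coef2 fcoef_tvM.
  have /negPf -> : ~~ (size (val i) <= m)%N; last by rewrite fcoef0.
  apply: contra big => sm; have := size_base i; rewrite /n1 => sE.
  have b2 : (n2 i <= m)%N by apply: leq_trans sm; rewrite -sE; lia.
  have a2 : (n12 i <= m)%N by apply: leq_trans sm; rewrite -sE; lia.
  by apply/andP; split; apply: leqW.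
- under eq_bigr => i _ do rewrite termE.
  rewrite -(big_map val xpredT (fun s => coef2 (G s) n m)) rE sum_bases_upto.
  rewrite coef2_series2 -[LHS]/(fcoef (twice_gf m) n) -(@partial_coef m) //.
  rewrite /partial_gf !fcoef_sum; apply: eq_bigr => b _.
  have := @tdvd_base_sum m.+2 b false 0 m (leqW (ltnSn m)).
  rewrite fcoefD fcoefN => /eqP; rewrite subr_eq0 => /eqP ->.
  rewrite /base_sum !fcoef_sum; apply: eq_bigr => a _.
  rewrite !fcoef_sum !big_seq; apply: eq_bigr => bs bsB.
  have [bK _ sb sa] := basesE bsB.
  by rewrite /coef2 /G bK sb sa /base_term /monomial [tv ^+ _ * _]mulrC.
Qed.
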